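(* Let $q\ge 2$ be a fixed integer and, for each $n\ge 1$, let $C(n,q)$ denote the maximum size of a cross-bifix-free code of length $n$ over an alphabet of size $q$. Then $$\liminf_{n\to\infty} \frac{C(n,q)}{q^n/n} \ge \frac{q-1}{qe}\qquad\text{and}\qquad \limsup_{n\to\infty} \frac{C(n,q)}{q^n/n}\le \frac12 .$$
   Context: Let $\mathbb Z_q=\{0,\dots,q-1\}$ be the alphabet of size $q$. For a word $\mathbf u\in\mathbb Z_q^n$, a word $\mathbf v$ is a prefix (resp. suffix) of $\mathbf u$ if $\mathbf u=(\mathbf v,\mathbf w)$ (resp. $\mathbf u=(\mathbf w,\mathbf v)$) for some word $\mathbf w$; only nonempty prefixes and suffixes of length strictly less than $n$ are considered. A cross-bifix-free code of length $n$ over $\mathbb Z_q$ is a set of words in $\mathbb Z_q^n$ such that no prefix (of any length) of any word in the set is a suffix of any word in the set, including the word itself. $C(n,q)$ is the maximum cardinality of such a set. Here $e$ is the base of the natural logarithm. *)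

(* Defs.v *)
From HB Require Import structures.
From mathcomp Require Import all_boot all_order all_algebra.
From mathcomp Require Import all_classical all_reals all_analysis.

Set Implicit Arguments.
Unset Strict Implicit.
Unset Printing Implicit Defensive.

Import Order.TTheory GRing.Theory Num.Theory.

(* The words u and u' may coincide: each word must also be bifix-free. *)
Definition cross_bifix_free (q n : nat) (S : {set n.-tuple 'I_q}) : Prop :=
  forall u u' : n.-tuple 'I_q, u \in S -> u' \in S ->
  forall v : seq 'I_q, 0 < size v < n -> ~ (prefix v u /\ suffix v u').

(* The empty set is cross-bifix-free, so this is a genuine maximum. *)
Definition max_cbf (q n : nat) : nat :=
  \max_(S : {set n.-tuple 'I_q} | `[< cross_bifix_free S >]) #|S|.

(* The value at n = 0 (division by zero) is irrelevant to the limits. *)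
Definition cbf_ratio (R : realType) (q n : nat) : R :=
  ((max_cbf q n)%:R / (q%:R ^+ n / n%:R))%R.

(* Main.v *)
(* Upper bound. Read the words of length 2n-1 cyclically: two code words
   starting at different positions of such a word would overlap, so at most
   one of its 2n-1 windows of length n is a code word, whence (2n-1) C(n,q) <=
   q^n.

   Lower bound. Take a set S of words 0^j 1 x 1 with |x| = j - 2; it is a
   cross-bifix-free code of length k = 2j. Keep the words s t of length n with
   s in S, where t avoids S, does not end in 0, and has no suffix of length in
   ]j, k[ starting with 0^j: these form a cross-bifix-free code. Choosing
   q^(j+2) <= n < q^(j+3) leaves room for |S| = floor(q^k / n). The number
   f(m) of words of length m avoiding S satisfies q f(m) <= f(m+1) + |S|
   f(m+1-k), hence f(i+1) >= q (1 - 1/m) f(i) with m = n - k, and f(m) >= q^m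
   (1 - 1/m)^m is about q^m / e. Only the condition on the last letter of t
   costs a nonvanishing proportion, namely the factor 1 - 1/q. *)
Require Import Defs.
From HB Require Import structures.
From mathcomp Require Import all_boot all_order all_algebra.
From mathcomp Require Import all_classical all_reals all_analysis.
From mathcomp Require Import zify ring lra.

Set Implicit Arguments.
Unset Strict Implicit.
Unset Printing Implicit Defensive.

Import Order.TTheory GRing.Theory Num.Theory numFieldNormedType.Exports.

(** * Sums over words and the upper bound on codes *)

Lemma sum_tuple_cons (A : finType) (m : nat) (F : seq A -> nat) :
  \sum_(t : m.+1.-tuple A) F t = \sum_(a : A) \sum_(t : m.-tuple A) F (a :: t).
Proof.
rewrite pair_bigA /= (reindex (fun p : A * m.-tuple A => [tuple of p.1 :: p.2])) //=.
exists (fun t : m.+1.-tuple A => (thead t, [tuple of behead t])) => /=.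
  by move=> [a t] _ /=; congr (_, _); apply: val_inj.
by move=> t _ /=; rewrite -tuple_eta.
Qed.

Lemma sum_tuple_cat (A : finType) (m1 m2 : nat) (F : seq A -> nat) :
  \sum_(t : (m1 + m2).-tuple A) F t =
  \sum_(x : m1.-tuple A) \sum_(y : m2.-tuple A) F (x ++ y).
Proof.
elim: m1 F => [|m1 IH] F.
  rewrite (big_pred1 [tuple]) //= => t; apply/esym/eqP; exact: tuple0.
rewrite addSn sum_tuple_cons.
rewrite (sum_tuple_cons m1 (fun x => \sum_(y : m2.-tuple A) F (x ++ y))).
by apply: eq_bigr => a _; rewrite (IH (fun t => F (a :: t))).
Qed.

Lemma sum_tuple_const (A : finType) (m c : nat) :
  \sum_(t : m.-tuple A) c = #|A| ^ m * c.
Proof. by rewrite sum_nat_const card_tuple. Qed.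

Lemma sum_tuple_eq (A : finType) (m : nat) (s : seq A) :
  size s = m -> \sum_(t : m.-tuple A) (val t == s) = 1.
Proof.
move=> hs; subst m; by rewrite -big_mkcond /= (big_pred1 (in_tuple s)) ?sum1_card.
Qed.

Lemma sum_tuple_mem (A : finType) (m : nat) (S : {set m.-tuple A}) :
  \sum_(t : m.-tuple A) (val t \in [seq val s | s <- enum S]) = #|S|.
Proof.
rewrite -sum1_card [RHS]big_mkcond /=; apply: eq_bigr => t _.
by rewrite mem_map ?mem_enum; [case: (t \in S) | exact: val_inj].
Qed.

(** The windows at positions 0 and [d] share the [n - d] letters from position [d] on, which form a
    suffix of the first window and a prefix of the second. *)
Lemma cbf_rot_half (q n : nat) (S : {set n.-tuple 'I_q}) (w : seq 'I_q) (d : nat) :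
  cross_bifix_free S -> size w = n.*2.-1 -> 0 < d < n ->
  ~ (take n w \in [seq val s | s <- enum S] /\
     take n (rot d w) \in [seq val s | s <- enum S]).
Proof.
move=> hS hw /andP[d0 dn] [/mapP[u uS eu] /mapP[u' u'S eu']].
rewrite !mem_enum in uS u'S.
apply: (hS u' u u'S uS (take (n - d) (drop d w))).
  by rewrite size_take size_drop hw; case: ifP; lia.
split.
  rewrite -[X in prefix _ X]/(val u') -eu'.
  have -> : take (n - d) (drop d w) = take (n - d) (take n (rot d w)).
    by rewrite take_takel ?leq_subr // /rot takel_cat // size_drop hw; lia.
  exact: prefix_take.
rewrite -[X in suffix _ X]/(val u) -eu.
by apply/suffixP; exists (take d w); rewrite -{1}(subnKC (ltnW dn)) takeD.
Qed.

(** On a circle of [2n - 1] letters one of the two distances [d] and [2n - 1 - d] is below [n]; in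
    the second case the windows exchange roles. *)
Lemma cbf_rot (q n : nat) (S : {set n.-tuple 'I_q}) (w : seq 'I_q) (d : nat) :
  cross_bifix_free S -> size w = n.*2.-1 -> 0 < d < size w ->
  ~ (take n w \in [seq val s | s <- enum S] /\
     take n (rot d w) \in [seq val s | s <- enum S]).
Proof.
move=> hS hw dw; have [dn|dn] := ltnP d n.
  by apply: (cbf_rot_half hS hw (d := d)); lia.
move=> [a b]; apply: (cbf_rot_half hS (w := rot d w) (d := size w - d)).
- by rewrite size_rot.
- by lia.
- split=> //; rewrite -rotD subnK ?rot_oversize //; lia.
Qed.

Lemma cbf_card_bound (q n : nat) (S : {set n.-tuple 'I_q}) :
  0 < n -> cross_bifix_free S -> n.*2.-1 * #|S| <= q ^ n.
Proof.
move=> n0 hS; set N := n.*2.-1.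
pose W := [seq val s | s <- enum S].
have hN : N = n + n.-1 by rewrite /N; lia.
(* For [q = 0] there are no words of positive length; otherwise [q ^ n.-1] can be cancelled at the
   end. *)
case: (posnP q) => [q0|q0].
  have -> : #|S| = 0; last by rewrite muln0.
  apply/eqP; rewrite cards_eq0; apply/eqP/setP => t; rewrite !inE.
  by case: n n0 S hS @N W hN t => // n _ S _ N W _ t; case: (thead t) => i; rewrite {1}q0.
have key (w : N.-tuple 'I_q) : \sum_(i < N) (take n (rot i w) \in W) <= 1.
  rewrite leqNgt -big_mkcond /= sum1_card; apply/negP => /card_gt1P [i [i' [ii i'i nii]]].
  move: ii i'i; rewrite !unfold_in.
  wlog lt : i i' nii / (i < i')%N => [hw|].
    by case: (ltngtP i i') => h a b; [exact: hw h a b | by apply: hw h b a; rewrite eq_sym |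
      by move/val_inj: h nii => ->; rewrite eqxx].
  move=> a b; have iN := ltn_ord i'.
  apply: (cbf_rot hS (w := rot i w) (d := i' - i)); rewrite ?size_rot ?size_tuple //.
    by rewrite subn_gt0 lt /=; lia.
  by rewrite -rotD ?subnK ?size_tuple; try lia; split.
have : \sum_(w : N.-tuple 'I_q) \sum_(i < N) (take n (rot i w) \in W) <= q ^ N.
  by rewrite -[q ^ N]muln1 -[q in q ^ N]card_ord -sum_tuple_const; apply: leq_sum => w _.
rewrite exchange_big /=.
under eq_bigr => i _.
  have -> : \sum_(w : N.-tuple 'I_q) (take n (rot i w) \in W) = #|S| * q ^ n.-1.
    (* Rotation permutes the words, so every position contributes as much as position 0. *)
    transitivity (\sum_(w : N.-tuple 'I_q) (take n w \in W)).
      rewrite [RHS](reindex (fun w : N.-tuple 'I_q => [tuple of rot i w])) //=.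
      exists (fun w : N.-tuple 'I_q => [tuple of rotr i w]) => w _;
        apply: val_inj; [exact: rotK| exact: rotrK].
    rewrite hN (sum_tuple_cat _ _ (fun w => nat_of_bool (take n w \in W))).
    transitivity (\sum_(x : n.-tuple 'I_q) (val x \in W) * q ^ n.-1).
      apply: eq_bigr => x _; rewrite mulnC -[q in q ^ _]card_ord -sum_tuple_const.
      by apply: eq_bigr => y _; rewrite take_size_cat ?size_tuple.
    by rewrite -big_distrl /= sum_tuple_mem.
  over.
rewrite sum_nat_const card_ord hN expnD mulnA leq_pmul2r ?expn_gt0 ?q0 //.
Qed.

(** * Words avoiding a set *)

Definition avoids (A : finType) (k : nat) (S : {set k.-tuple A}) (t : seq A) : bool :=
  [forall s in S, ~~ infix s t].

(** For [i <= size t] this concerns the suffix of length [i] and its first [j] letters. The case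
    [j = i = 1] says that the last letter is [z]. *)
Definition ends_with_block (A : eqType) (z : A) (j i : nat) (t : seq A) : bool :=
  take j (drop (size t - i) t) == nseq j z.

Definition good_tail (A : finType) (k : nat) (S : {set k.-tuple A}) (z : A) (j : nat)
    (t : seq A) : bool :=
  [&& avoids S t, ~~ ends_with_block z 1 1 t &
      [forall i : 'I_k, (j < i) ==> ~~ ends_with_block z j i t]].

Lemma avoids_infix (A : finType) (k : nat) (S : {set k.-tuple A}) (t t' : seq A) :
  infix t' t -> avoids S t -> avoids S t'.
Proof.
move=> tt' /forall_inP h; apply/forall_inP => s sS.
by apply: contra (h s sS) => st'; exact: infix_trans st' tt'.
Qed.

(** Since [t] avoids [S], an occurrence in [a :: t] must start at [a]; what follows it is a suffix
    of [t], as [k > 0]. *)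
Lemma avoids_cons (A : finType) (k : nat) (S : {set k.-tuple A}) (a : A) (t : seq A) :
  0 < k -> avoids S t ->
  avoids S (a :: t) ||
  (take k (a :: t) \in [seq val s | s <- enum S]) && avoids S (drop k (a :: t)).
Proof.
move=> k0 ht; case: (boolP (avoids S (a :: t))) => //= /forall_inPn[s sS].
rewrite negbK => /orP[pre|inf]; last by move/forall_inP: ht => /(_ s sS) /negP[].
apply/andP; split.
  have -> : take k (a :: t) = val s.
    by case/prefixP: pre => t' ->; rewrite take_size_cat ?size_tuple.
  by rewrite mem_map ?mem_enum //; exact: val_inj.
apply: avoids_infix ht; case: k S k0 s sS pre => // k S _ s sS pre /=.
by rewrite -{2}(cat_take_drop k t) suffix_infix.
Qed.

Definition num_avoiding (A : finType) (k : nat) (S : {set k.-tuple A}) (m : nat) : nat :=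
  \sum_(t : m.-tuple A) avoids S t.

Lemma num_avoiding_rec (A : finType) (k : nat) (S : {set k.-tuple A}) (m p : nat) :
  0 < k -> m.+1 = k + p ->
  #|A| * num_avoiding S m <= num_avoiding S m.+1 + #|S| * num_avoiding S p.
Proof.
move=> k0 mp.
have -> : #|A| * num_avoiding S m = \sum_(a : A) \sum_(t : m.-tuple A) avoids S t.
  by rewrite sum_nat_const.
have -> : #|S| * num_avoiding S p = \sum_(t : m.+1.-tuple A)
    (take k t \in [seq val s | s <- enum S]) && avoids S (drop k t).
  rewrite mp (sum_tuple_cat _ _ (fun t => nat_of_bool
    ((take k t \in [seq val s | s <- enum S]) && avoids S (drop k t)))).
  rewrite -(sum_tuple_mem S) big_distrl /=; apply: eq_bigr => x _.
  rewrite big_distrr /=; apply: eq_bigr => y _.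
  by rewrite take_size_cat ?size_tuple // drop_size_cat ?size_tuple // mulnb.
rewrite /num_avoiding (sum_tuple_cons _ (avoids S)).
rewrite (sum_tuple_cons _ (fun t => nat_of_bool
    ((take k t \in [seq val s | s <- enum S]) && avoids S (drop k t)))).
rewrite -big_split; apply: leq_sum => a _; rewrite -big_split; apply: leq_sum => t _.
case: (boolP (avoids S t)) => // ht.
have := avoids_cons a k0 ht.
by case: (avoids S (a :: t)) => //= ->.
Qed.

Lemma num_avoiding_rec_short (A : finType) (k : nat) (S : {set k.-tuple A}) (m : nat) :
  m.+1 < k -> #|A| * num_avoiding S m <= num_avoiding S m.+1.
Proof.
move=> mk; have all_avoid i : i < k -> num_avoiding S i = #|A| ^ i.
  move=> ik; rewrite -[RHS]muln1 -sum_tuple_const; apply: eq_bigr => t _.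
  suff -> : avoids S t by [].
  apply/forall_inP => s _; apply/negP => /size_infix.
  by rewrite !size_tuple leqNgt ik.
by rewrite !all_avoid ?expnS //; exact: ltnW.
Qed.

(** Avoidance is asked only of the letters before the block, so the front, the forced block and the
    [i - j] final letters are chosen independently. *)
Lemma num_avoiding_block (A : finType) (k : nat) (S : {set k.-tuple A}) (z : A)
    (j i m : nat) :
  j <= i <= m ->
  \sum_(t : m.-tuple A) avoids S (take (m - i) t) && ends_with_block z j i t =
  num_avoiding S (m - i) * #|A| ^ (i - j).
Proof.
move=> /andP[ji im].
transitivity (\sum_(t : m.-tuple A)
    avoids S (take (m - i) t) && (take j (drop (m - i) t) == nseq j z)).
  by apply: eq_bigr => t _; rewrite /ends_with_block size_tuple.
have e : (m - i) + (j + (i - j)) = m by lia.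
have split_m (F : seq A -> nat) : \sum_(t : m.-tuple A) F t =
    \sum_(x : (m - i).-tuple A) \sum_(y : (j + (i - j)).-tuple A) F (x ++ y).
  by rewrite -sum_tuple_cat e.
rewrite (split_m (fun t => nat_of_bool
  (avoids S (take (m - i) t) && (take j (drop (m - i) t) == nseq j z)))).
rewrite big_distrl /=; apply: eq_bigr => x _.
rewrite (sum_tuple_cat _ _ (fun y => nat_of_bool
  (avoids S (take (m - i) (x ++ y)) && (take j (drop (m - i) (x ++ y)) == nseq j z)))).
transitivity (\sum_(y : j.-tuple A) (val y == nseq j z) * (#|A| ^ (i - j) * avoids S x)).
  apply: eq_bigr => y _.
  rewrite mulnCA -sum_tuple_const; apply: eq_bigr => w _.
  rewrite take_size_cat ?size_tuple // drop_size_cat ?size_tuple //.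
  by rewrite take_size_cat ?size_tuple // mulnC mulnb andbC.
by rewrite -big_distrl /= sum_tuple_eq ?size_nseq // mul1n mulnC.
Qed.

(** Union bound: an avoiding word that is not good violates the last-letter condition or one block
    condition. Each violation is overcounted by keeping avoidance on the front part only. *)
Lemma num_good_tail (A : finType) (k : nat) (S : {set k.-tuple A}) (z : A) (j m : nat) :
  0 < m -> k <= m ->
  num_avoiding S m <=
  \sum_(t : m.-tuple A) good_tail S z j t + num_avoiding S m.-1 +
  \sum_(i < k | j < i) num_avoiding S (m - i) * #|A| ^ (i - j).
Proof.
move=> m0 km.
have -> : num_avoiding S m.-1 = \sum_(t : m.-tuple A)
    avoids S (take (m - 1) t) && ends_with_block z 1 1 t.
  by rewrite num_avoiding_block // subn1 muln1.
under [X in _ <= _ + X]eq_bigr => i ji.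
  rewrite -(num_avoiding_block S z); last by rewrite (ltnW ji) (leq_trans (ltnW (ltn_ord i)) km).
  over.
rewrite exchange_big -!big_split /=; apply: leq_sum => t _.
case: (boolP (avoids S t)) => //= ht.
have htake i : avoids S (take i t) by apply: avoids_infix ht; exact/prefixW/prefix_take.
rewrite htake /=.
case: (boolP (good_tail S z j t)) => //; rewrite /good_tail ht /= negb_and negbK.
case/orP => [->|]; first by rewrite add0n.
move=> /forallPn[i]; rewrite negb_imply negbK => /andP[ji bad].
by rewrite (bigD1 i) //= htake bad; lia.
Qed.

(** * The code *)

Definition extended_code (q k : nat) (S : {set k.-tuple 'I_q}) (z : 'I_q) (j m : nat) :
    {set (k + m).-tuple 'I_q} :=
  [set u : (k + m).-tuple 'I_q |
    (take k u \in [seq val s | s <- enum S]) && good_tail S z j (drop k u)].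

Lemma prefix_eq_take (T : eqType) (v u : seq T) : prefix v u -> v = take (size v) u.
Proof. by rewrite prefixE => /eqP. Qed.

Lemma suffix_eq_drop (T : eqType) (v u : seq T) :
  suffix v u -> v = drop (size u - size v) u.
Proof. by move=> /suffixP[w ->]; rewrite size_cat addnK drop_size_cat. Qed.

(** Let [l] be the length of an overlap. If [l <= j], the tail would end in [z]; if [j < l < k], it
    would have a suffix of length [l] starting with [j] letters [z]; if [k <= l <= m], it would
    contain a word of [S]; if [l > m], two words of [S] would overlap in [l - m] letters. *)
Lemma extended_code_cbf (q k : nat) (S : {set k.-tuple 'I_q}) (z : 'I_q) (j m : nat) :
  cross_bifix_free S -> k <= m ->
  (forall s : k.-tuple 'I_q, s \in S -> take j s = nseq j z) ->
  cross_bifix_free (extended_code S z j m).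
Proof.
move=> hS km hz u u'; rewrite !inE.
move=> /andP[/mapP[s]]; rewrite mem_enum => sS eu _.
move=> /andP[/mapP[s']]; rewrite mem_enum => s'S eu' /and3P[av nz blk] v.
set t' := drop k u' in av nz blk.
have szt' : size t' = m by rewrite size_drop size_tuple addKn.
have eu'' : val u' = val s' ++ t' by rewrite -eu' cat_take_drop.
move=> /andP[v0 vkm] [pre suf].
have ev := prefix_eq_take pre; have := suffix_eq_drop suf; rewrite size_tuple.
set l := size v in ev v0 vkm * => ev'.
have evs : take (minn l k) v = take (minn l k) s.
  by rewrite -eu {1}ev take_takel ?geq_minl // take_takel ?geq_minr.
have [lm|lm] := leqP l m.
  have evt : v = drop (m - l) t'.
    by rewrite {1}ev' /t' drop_drop; congr drop; lia.
  have [lk|kl] := ltnP l k; last first.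
    move: evs; rewrite (minn_idPr kl) [take k s]take_oversize ?size_tuple // => evs.
    move/forall_inP: av => /(_ s sS) /negP[]; rewrite -evs.
    apply: (infix_trans (prefixW (prefix_take _ _))); apply: suffixW.
    by rewrite evt suffix_drop.
  move: evs; rewrite (minn_idPl (ltnW lk)) take_size => evs.
  have [lj|jl] := leqP l j.
    move/negP: nz; apply; rewrite /ends_with_block szt'.
    have -> : drop (m - 1) t' = drop (l - 1) v.
      by rewrite evt drop_drop; congr drop; lia.
    have -> : v = nseq l z by rewrite evs -(take_takel _ lj) hz // take_nseq.
    by rewrite drop_nseq subKn.
  move/forallP: blk => /(_ (Ordinal lk)) /=; rewrite jl /= => /negP[].
  by rewrite /ends_with_block szt' -evt evs take_takel ?(ltnW jl) // hz.
have evs' : v = drop (k + m - l) s' ++ t'.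
  by rewrite {1}ev' eu'' drop_cat size_tuple; case: ifP => //; lia.
have kl : k <= l by lia.
move: evs; rewrite (minn_idPr kl) [take k s]take_oversize ?size_tuple // => evs.
apply: (hS s s' sS s'S (drop (k + m - l) s')).
  by rewrite size_drop size_tuple; lia.
split; last exact: suffix_drop.
rewrite -evs evs' take_cat size_drop size_tuple.
case: ifP; first lia.
by move=> _; exact: prefix_prefix.
Qed.

Lemma card_extended_code (q k : nat) (S : {set k.-tuple 'I_q}) (z : 'I_q) (j m : nat) :
  #|extended_code S z j m| = #|S| * \sum_(t : m.-tuple 'I_q) good_tail S z j t.
Proof.
transitivity (\sum_(u : (k + m).-tuple 'I_q)
  ((take k u \in [seq val s | s <- enum S]) && good_tail S z j (drop k u))).
  rewrite -sum1_card big_mkcond /=; apply: eq_bigr => u _; rewrite inE.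
  by case: (_ && _).
rewrite (sum_tuple_cat _ _ (fun u => nat_of_bool
  ((take k u \in [seq val s | s <- enum S]) && good_tail S z j (drop k u)))).
rewrite -(sum_tuple_mem S) big_distrl /=; apply: eq_bigr => x _.
rewrite big_distrr /=; apply: eq_bigr => y _.
by rewrite take_size_cat ?size_tuple // drop_size_cat ?size_tuple // mulnb.
Qed.

Definition block_code (q p : nat) (z o : 'I_q) (Z : {set p.-tuple 'I_q}) :
    {set (p.+2 + p.+2).-tuple 'I_q} :=
  [set [tuple of nseq p.+2 z ++ (o :: rcons x o)] | x : p.-tuple 'I_q in Z].

Lemma card_block_code (q p : nat) (z o : 'I_q) (Z : {set p.-tuple 'I_q}) :
  #|block_code z o Z| = #|Z|.
Proof.
apply: card_imset => x y /(congr1 val) /= [] /eqP.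
by rewrite eqseq_cat // eqxx /= eqseq_cons eqxx /= eqseq_rcons eqxx andbT => /eqP /val_inj.
Qed.

Lemma block_code_cbf (q p : nat) (z o : 'I_q) (Z : {set p.-tuple 'I_q}) :
  o != z -> cross_bifix_free (block_code z o Z).
Proof.
move=> oz u u' /imsetP[x _ ->] /imsetP[x' _ ->] v.
move=> /andP[v0 vk] [pre suf].
have ev : v = take (size v) (nseq p.+2 z ++ (o :: rcons x o)) := prefix_eq_take pre.
have ev' : v = drop (p.+2 + p.+2 - size v) (nseq p.+2 z ++ (o :: rcons x' o)).
  have sz : size (nseq p.+2 z ++ (o :: rcons x' o)) = p.+2 + p.+2.
    by rewrite size_cat size_nseq /= size_rcons size_tuple.
  by rewrite -sz; exact: suffix_eq_drop suf.
set j := p.+2 in ev ev' vk; set l := size v in ev ev' v0 vk.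
have [jl|lj] := leqP j l.
  (* The letter o following the block of z's of u' falls inside the block of u. *)
  have e1 : nth z v (l - j) = z.
    rewrite ev nth_take; last by lia.
    by rewrite nth_cat size_nseq nth_nseq ifT ?if_same //; lia.
  have e2 : nth z v (l - j) = o.
    rewrite ev' nth_drop.
    have -> : j + j - l + (l - j) = j by lia.
    by rewrite nth_cat size_nseq ltnn subnn.
  by move/eqP: oz; rewrite -e1 e2.
(* A shorter overlap lies inside the block of [u], yet its last letter is the final [o] of [u']. *)
have e1 : nth z v l.-1 = z.
  rewrite ev nth_take; last by lia.
  by rewrite nth_cat size_nseq nth_nseq ifT ?if_same //; lia.
have e2 : nth z v l.-1 = o.
  rewrite ev' nth_drop.
  have -> : j + j - l + l.-1 = (j + j).-1 by lia.
  rewrite nth_cat size_nseq; case: ifP => [h|_]; first by exfalso; lia.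
  have -> : (j + j).-1 - j = p.+1 by rewrite /j; lia.
  by rewrite /= nth_rcons size_tuple ltnn eqxx.
by move/eqP: oz; rewrite -e1 e2.
Qed.

Lemma exists_set_card (T : finType) (M : nat) : M <= #|T| -> exists Z : {set T}, #|Z| = M.
Proof.
move=> hM; exists [set x in take M (enum T)].
rewrite cardsE; have /card_uniqP -> : uniq (take M (enum T)) by rewrite take_uniq ?enum_uniq.
by rewrite size_takel // -cardE.
Qed.

Lemma card_le_max_cbf (q n : nat) (S : {set n.-tuple 'I_q}) :
  cross_bifix_free S -> #|S| <= max_cbf q n.
Proof. by move=> hS; apply: (leq_bigmax_cond (F := fun S : {set _} => #|S|)); exact/asboolP. Qed.

(** The losses are added to the right-hand side, which avoids truncated subtraction. The set [S]
    stays abstract: later estimates use only its cardinality. *)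
Lemma max_cbf_ge (q p M m : nat) :
  1 < q -> M <= q ^ p -> p.+2 + p.+2 <= m ->
  exists2 S : {set (p.+2 + p.+2).-tuple 'I_q}, #|S| = M &
  M * num_avoiding S m <= max_cbf q ((p.+2 + p.+2) + m) +
    M * (num_avoiding S m.-1 + \sum_(i < p.+2 + p.+2 | p.+2 < i)
                           num_avoiding S (m - i) * q ^ (i - p.+2)).
Proof.
case: q => [|[|q]] // _ hM km.
have [Z hZ] : exists Z : {set p.-tuple 'I_q.+2}, #|Z| = M.
  by apply: exists_set_card; rewrite card_tuple card_ord.
pose S := block_code ord0 ord_max Z.
have hS : #|S| = M by rewrite card_block_code.
exists S => //.
have code : cross_bifix_free (extended_code S ord0 p.+2 m).
  apply: extended_code_cbf => //; first by apply: block_code_cbf.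
  by move=> s /imsetP[x _ ->]; rewrite take_size_cat // size_nseq.
have := card_le_max_cbf code; rewrite card_extended_code hS => bound.
have key := @num_good_tail _ _ S ord0 p.+2 m; rewrite card_ord in key.
apply: (leq_trans (leq_mul (leqnn M) (key _ km))); first by lia.
by rewrite -addnA mulnDr leq_add2r.
Qed.

(** * Asymptotics *)

Local Open Scope classical_set_scope.
Local Open Scope ring_scope.

(* The hypothesis on #|S| makes growth by the factor #|A| * c over the previous
   k - 1 steps absorb the loss term of the recurrence. *)
Lemma num_avoiding_step (R : realType) (A : finType) (k : nat) (S : {set k.-tuple A}) (c : R) :
  (0 < k)%N -> 0 <= c <= 1 ->
  #|S|%:R <= #|A|%:R ^+ k * (1 - c) * c ^+ k.-1 ->
  forall m : nat, #|A|%:R * c * (num_avoiding S m)%:R <= (num_avoiding S m.+1)%:R.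
Proof.
move=> k0 /andP[c0 c1] hS m; set Q : R := #|A|%:R.
have Q0 : 0 <= Q := ler0n _ _.
elim/ltn_ind: m => m IH.
have [mk|km] := ltnP m.+1 k.
  have := num_avoiding_rec_short S mk; rewrite -(ler_nat R) natrM; apply: le_trans.
  by rewrite mulrAC ler_piMr // mulr_ge0.
have [p mp] : exists p, m.+1 = (k + p)%N by exists (m.+1 - k)%N; rewrite subnKC.
have := num_avoiding_rec S k0 mp; rewrite -(ler_nat R) natrD !natrM -/Q => rec.
have iter i : (p + i <= m)%N ->
    (Q * c) ^+ i * (num_avoiding S p)%:R <= (num_avoiding S (p + i))%:R.
  elim: i => [|i IHi] hi; first by rewrite expr0 mul1r addn0.
  rewrite exprS -mulrA addnS; apply: le_trans (IH (p + i)%N _); last by lia.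
  by apply: ler_wpM2l; [exact: mulr_ge0 | apply: IHi; lia].
have := iter k.-1; have -> : (p + k.-1 = m)%N by lia.
move=> /(_ (leqnn _)); rewrite exprMn => loss.
have : #|S|%:R * (num_avoiding S p)%:R <= Q * (1 - c) * (num_avoiding S m)%:R.
  apply: le_trans (ler_wpM2r (ler0n _ _) hS) _.
  have -> : Q ^+ k * (1 - c) * c ^+ k.-1 * (num_avoiding S p)%:R =
    Q * (1 - c) * (Q ^+ k.-1 * c ^+ k.-1 * (num_avoiding S p)%:R).
    by rewrite -{1}(prednK k0) exprS; ring.
  by apply: ler_wpM2l loss; rewrite mulr_ge0 // subr_ge0.
lra.
Qed.

Lemma num_avoiding_growth (R : realType) (A : finType) (k : nat) (S : {set k.-tuple A}) (c : R) :
  (0 < k)%N -> 0 <= c <= 1 ->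
  #|S|%:R <= #|A|%:R ^+ k * (1 - c) * c ^+ k.-1 ->
  forall m i : nat, (#|A|%:R * c) ^+ i * (num_avoiding S m)%:R <= (num_avoiding S (m + i))%:R.
Proof.
move=> k0 c01 hS m; elim=> [|i IH]; first by rewrite expr0 mul1r addn0.
rewrite exprS -mulrA addnS; apply: le_trans (num_avoiding_step k0 c01 hS _).
by apply: ler_wpM2l IH; rewrite mulr_ge0 //; case/andP: c01.
Qed.

(** * Elementary inequalities and comparison of limits *)

Lemma bernoulli_ineq (R : realType) (x : R) (n : nat) : 0 <= x <= 1 -> 1 - n%:R * x <= (1 - x) ^+ n.
Proof.
move=> /andP[x0 x1]; elim: n => [|n IH]; first by rewrite mul0r subr0 expr0.
rewrite exprS; apply: le_trans (ler_wpM2l _ IH); last by rewrite subr_ge0.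
have : 0 <= n%:R * x ^+ 2 by rewrite mulr_ge0 // exprn_ge0.
by rewrite -natr1 -subr_ge0; apply: etrans; congr (0 <= _); ring.
Qed.

Lemma sqr_le_exp2 (x : nat) : (4 <= x)%N -> (x ^ 2 <= 2 ^ x)%N.
Proof.
elim: x => // x IH; rewrite leq_eqVlt => /orP[/eqP <- //|hx].
have := IH hx; rewrite (expnS 2) -!mulnn; move: (2 ^ x)%N => y; nia.
Qed.

(** Write [1 - 1/m] as the inverse of [1 + 1/(m-1)], bound the latter by [exp(1/(m-1))], and note
    [m/(m-1) = 1 + 1/(m-1)]. *)
Lemma exp_ge_powV (R : realType) (m : nat) : (1 < m)%N ->
  expR (- 1 - m.-1%:R^-1) <= (1 - m%:R^-1 : R) ^+ m.
Proof.
case: m => [|[|m]] // _ /=.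
have m0 : 0 < m.+1%:R :> R by rewrite ltr0n.
have m1 : 0 < m.+2%:R :> R by rewrite ltr0n.
have e2 : m.+2%:R = m.+1%:R + 1 :> R by rewrite natr1.
have -> : 1 - m.+2%:R^-1 = (1 + m.+1%:R^-1 : R)^-1.
  by rewrite e2; field; rewrite -?e2 ?lt0r_neq0 //; lra.
rewrite exprVn -[leLHS]invrK -expRN lef_pV2 ?posrE ?exprn_gt0 ?expR_gt0 ?addr_gt0 ?invr_gt0 //.
have -> : - (- 1 - m.+1%:R^-1) = m.+2%:R * m.+1%:R^-1 :> R.
  by rewrite e2; field; lra.
rewrite expRM_natl; apply: lerXn2r; rewrite ?nnegrE ?expR_ge0 ?expR_ge1Dx //.
Qed.

Lemma limn_esup_le_lim (R : realType) (u v : nat -> \bar R) (l : \bar R) :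
  (\forall n \near \oo, (u n <= v n)%E) -> v @ \oo --> l -> (limn_esup u <= l)%E.
Proof.
move=> [N _ uv] vl; rewrite -(cvg_limn_einf_sup vl).2 !limn_esup_lim.
apply: lee_lim; [exact: is_cvg_esups | exact: is_cvg_esups | ].
near=> n; apply: ge_ereal_sup => _ [k /= nk <-].
apply: le_trans (uv k _) _; first by apply: leq_trans nk; near: n; exists N.
by apply: ereal_sup_ubound; exists k.
Unshelve. all: by end_near. Qed.

Lemma limn_einf_ge_lim (R : realType) (u v : nat -> \bar R) (l : \bar R) :
  (\forall n \near \oo, (v n <= u n)%E) -> v @ \oo --> l -> (l <= limn_einf u)%E.
Proof.
move=> vu vl; rewrite /limn_einf leeNr.
apply: (@limn_esup_le_lim _ _ (\- v)%E); last exact: cvgeN.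
by near=> n; rewrite /= leeN2; near: n.
Unshelve. all: by end_near. Qed.

Lemma num_avoiding0 (A : finType) (k : nat) (S : {set k.-tuple A}) :
  (0 < k)%N -> num_avoiding S 0 = 1%N.
Proof.
move=> k0; rewrite /num_avoiding (big_pred1 [tuple]) => [|t]; last exact/esym/eqP/tuple0.
suff -> : avoids S [::] by [].
by apply/forall_inP => s _; rewrite infixs0 -size_eq0 size_tuple -lt0n.
Qed.

(** * Explicit lower bound with error parameter [h] *)

(** The exponential factor estimates the proportion of tails avoiding [S]; [(1 + h) / q] pays for
    the last letter and [4 * h] for all the block conditions together. *)
Lemma max_cbf_ge_rate (R : realType) (q p M m : nat) :
  (1 < q)%N -> (2 <= p)%N -> (M <= q ^ p)%N ->
  ((p.+2 + p.+2) ^ 2 <= (p.+2 + p.+2) + m)%N ->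
  (M * ((p.+2 + p.+2) + m) <= q ^ (p.+2 + p.+2))%N ->
  let h : R := p.+1%:R^-1 in
  0 <= 1 - (1 + h) / q%:R - 4 * h ->
  M%:R * (expR (- 1 - h) * q%:R ^+ m) * (1 - (1 + h) / q%:R - 4 * h) <=
  (max_cbf q ((p.+2 + p.+2) + m))%:R.
Proof.
move=> q1 p2 hMp hk hMk h; set D : R := 1 - _ - _ => D0.
have km : (p.+2 + p.+2 <= m)%N by rewrite -mulnn in hk; nia.
have [S hS main] := max_cbf_ge q1 hMp km.
pose k := (p.+2 + p.+2)%N; rewrite -/k in S hS km hk hMk main *.
have k8 : (8 <= k)%N by rewrite /k; lia.
have km2 : (2 * k <= m)%N by rewrite -mulnn in hk; nia.
set Q : R := q%:R; set K : R := k%:R; set m' : R := m%:R.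
have Q2 : 2 <= Q by rewrite /Q (ler_nat R 2 q).
have K8 : 8 <= K by rewrite /K (ler_nat R 8 k).
have mK : 2 * K <= m' by rewrite /K /m' -natrM ler_nat.
have hkR : K ^+ 2 <= K + m' by rewrite /K /m' -natrX -natrD ler_nat.
have m0 : 0 < m' by lra.
pose c : R := 1 - m'^-1.
have im0 : 0 <= m'^-1 by rewrite invr_ge0 ltW.
have im1 : m'^-1 <= 1 by rewrite invf_le1 //; lra.
have c01 : 0 <= c <= 1 by apply/andP; split; rewrite /c; lra.
have im01 : 0 <= m'^-1 <= 1 by rewrite im0 im1.
have cpow i : 1 - i%:R * m'^-1 <= c ^+ i by exact: bernoulli_ineq.
have loss : #|S|%:R <= #|'I_q|%:R ^+ k * (1 - c) * c ^+ k.-1 :> R.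
  rewrite hS card_ord -/Q.
  have : M%:R * (K + m') <= Q ^+ k by rewrite /K /m' /Q -natrD -natrM -natrX ler_nat.
  rewrite -ler_pdivlMr; last by lra.
  move/le_trans; apply; rewrite -mulrA; apply: ler_wpM2l; first by rewrite exprn_ge0.
  have -> : 1 - c = m'^-1 by rewrite /c; ring.
  (* Bernoulli's bound for [c ^+ k.-1] suffices: the numerator of the remaining difference is
     [K + m' - K ^+ 2], nonnegative by [hkR]. *)
  apply: (@le_trans _ _ (m'^-1 * (1 - (K - 1) * m'^-1))).
    rewrite -subr_ge0.
    have -> : m'^-1 * (1 - (K - 1) * m'^-1) - (K + m')^-1 =
              (K + m' - K ^+ 2) / ((K + m') * m' ^+ 2).
      by field; lra.
    by rewrite divr_ge0 ?subr_ge0 // mulr_ge0 ?exprn_ge0 //; lra.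
  apply: ler_wpM2l => //.
  have -> : K - 1 = k.-1%:R by rewrite /K -[k in LHS](prednK (ltn_trans _ k8)) // -natr1 addrK.
  exact: cpow.
have k0 : (0 < k)%N by [].
have growth := num_avoiding_growth k0 c01 loss.
rewrite card_ord -/Q in growth.
(* As [2k <= m], Bernoulli's inequality keeps [c ^+ i] above one half. *)
have c2 i : (i <= k)%N -> 1 <= 2 * c ^+ i.
  move=> ik; have := cpow i.
  have : i%:R * m'^-1 <= 2^-1.
    have : i%:R <= K by rewrite /K ler_nat.
    by rewrite ler_pdivrMr //; lra.
  lra.
set F : R := (num_avoiding S m)%:R.
have F0 : 0 <= F by [].
have h0 : 0 < h by rewrite invr_gt0 ltr0n.
have hp : h * p.+1%:R = 1 by rewrite mulVf ?pnatr_eq0.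
have mp : (p.+2 <= m)%N := leq_trans (leq_addr _ _) km.
have m_gt0 : (0 < m)%N := ltn_trans (ltn0Sn _) mp.
have ch : 1 <= c * (1 + h).
  have : m'^-1 <= p.+2%:R^-1 by rewrite lef_pV2 ?posrE ?ltr0n // ler_nat.
  have -> : p.+2%:R^-1 = 1 - (1 + h)^-1.
    by rewrite /h -(natr1 p.+1); field; have := ler0n R p; lra.
  have c1 : 0 < 1 + h by rewrite addr_gt0.
  by rewrite -ler_pdivrMr // /c; move: (1 + h)^-1 => y; rewrite mul1r lerBrDr addrC -lerBrDr.
have last_bound : (num_avoiding S m.-1)%:R <= (1 + h) / Q * F.
  have := growth m.-1 1%N; rewrite expr1 addn1 prednK //.
  move=> g; rewrite mulrAC ler_pdivlMr; last by lra.
  apply: (@le_trans _ _ ((1 + h) * (Q * c * (num_avoiding S m.-1)%:R))).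
    have -> : (1 + h) * (Q * c * (num_avoiding S m.-1)%:R) =
      c * (1 + h) * ((num_avoiding S m.-1)%:R * Q) by ring.
    by rewrite ler_peMl // mulr_ge0 //; lra.
  by apply: ler_wpM2l g; lra.
(* Growth over [i] steps from length [m - i] gives a bound that does not depend on [i]. *)
have block_bound (i : 'I_k) : (p.+2 < i)%N ->
    (num_avoiding S (m - i))%:R * Q ^+ (i - p.+2) <= 2 * F / Q ^+ p.+2.
  move=> ji; have := growth (m - i)%N i; rewrite subnK; last first.
    exact: leq_trans (ltnW (ltn_ord i)) km.
  move=> g; rewrite ler_pdivlMr; last by rewrite exprn_gt0 //; lra.
  rewrite -mulrA -exprD subnK ?(ltnW ji) //.
  apply: (@le_trans _ _ (2 * ((Q * c) ^+ i * (num_avoiding S (m - i))%:R))); last first.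
    by apply: ler_wpM2l.
  rewrite exprMn.
  have -> : 2 * (Q ^+ i * c ^+ i * (num_avoiding S (m - i))%:R) =
    2 * c ^+ i * ((num_avoiding S (m - i))%:R * Q ^+ i) by ring.
  by rewrite ler_peMl ?mulr_ge0 ?exprn_ge0 ?c2 // ltnW.
have Q_gt0 : 0 < Q by lra.
have QQ : 0 < Q ^+ p.+2 by rewrite exprn_gt0.
have blocks : \sum_(i < k | (p.+2 < i)%N) (num_avoiding S (m - i))%:R * Q ^+ (i - p.+2)
    <= 4 * h * F.
  apply: (@le_trans _ _ (\sum_(i < k) 2 * F / Q ^+ p.+2)).
    rewrite big_mkcond /=; apply: ler_sum => i _; case: ifP => [/block_bound //|_].
    by apply: divr_ge0; [exact: mulr_ge0 | exact: ltW].
  rewrite sumr_const card_ord -[leLHS]mulr_natr.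
  have -> : k%:R = 2 * p.+2%:R :> R by rewrite /k natrD; ring.
  (* There are at most [2 * p.+2] terms; this inequality makes [p.+2 / Q ^+ p.+2] at most
     [1 / p.+2], hence at most [h]. *)
  have sq : (p.+2%:R : R) ^+ 2 <= Q ^+ p.+2.
    rewrite /Q -!natrX ler_nat; apply: leq_trans (sqr_le_exp2 _) _; first exact: p2.
    by rewrite leq_exp2r.
  have : p.+2%:R / Q ^+ p.+2 <= h.
    rewrite ler_pdivrMr //; apply: (@le_trans _ _ (h * p.+2%:R ^+ 2)); last first.
      by rewrite ler_wpM2l // ltW.
    rewrite expr2 mulrA ler_peMl // -(natr1 p.+1) mulrDr hp; lra.
  have -> : 2 * F / Q ^+ p.+2 * (2 * p.+2%:R) = 4 * F * (p.+2%:R / Q ^+ p.+2) by field; lra.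
  by move=> e; rewrite [leRHS]mulrAC ler_wpM2l // mulr_ge0.
have total : M%:R * F * D <= (max_cbf q (k + m))%:R.
  move: main; rewrite -(ler_nat R) natrD !natrM natrD -/F [(\sum_(i < k | _) _)%:R]natr_sum.
  under eq_bigr => i _ do rewrite natrM natrX.
  rewrite -/Q => main.
  have := ler_wpM2l (ler0n R M) (lerD last_bound blocks).
  have -> : M%:R * F * D = M%:R * F - M%:R * ((1 + h) / Q * F + 4 * h * F).
    by rewrite /D; ring.
  lra.
apply: le_trans total; apply: ler_wpM2r => //; apply: ler_wpM2l => //.
(* Growth from the empty word gives [F >= (Q * c) ^+ m], and [c ^+ m] is bounded by [exp_ge_powV],
   where [m.-1 >= p.+1] allows [h] in the exponent. *)
have := growth 0%N m; rewrite num_avoiding0 // mulr1 add0n -/F; apply: le_trans.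
rewrite exprMn mulrC; apply: ler_wpM2l; first by rewrite exprn_ge0.
apply: le_trans (exp_ge_powV R _); last exact: leq_trans mp.
have pm : (p.+1 <= m.-1)%N by rewrite -ltnS prednK.
by rewrite ler_expR lerD2l lerN2 lef_pV2 ?posrE ?ltr0n ?ler_nat // (leq_trans _ pm).
Qed.

(** The factor [1 - 2 * h] accounts for rounding [q ^ k / n] down to an integer; the other two come
    from [max_cbf_ge_rate]. At [h = 0] this is the claimed constant. *)
Definition lower_rate (R : realType) (q : nat) (h : R) : R :=
  (1 - 2 * h) * expR (- 1 - h) * (1 - (1 + h) / q%:R - 4 * h).

(** With [k = 2p + 4], the lower bound on [n] ensures both [q ^ k / n <= q ^ p], so that enough
    words [x] exist, and [k ^ 2 <= n]; the upper bound makes the rounding loss [n / q ^ k] at most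
    [2 * h]. *)
Lemma cbf_ratio_ge (R : realType) (q n p : nat) :
  (1 < q)%N -> (2 <= p)%N -> (q ^ (p + 4) <= n < q ^ (p + 5))%N ->
  lower_rate q (p.+1%:R^-1 : R) <= cbf_ratio R q n.
Proof.
move=> q1 p2 /andP[nl nu]; rewrite /lower_rate; set h : R := p.+1%:R^-1.
have h0 : 0 < h by rewrite invr_gt0 ltr0n.
have h2 : 2 * h <= 1.
  by rewrite /h ler_pdivrMr ?ltr0n // mul1r (ler_nat R 2); lia.
(* If the last factor is negative, the rate is nonpositive and the claim is trivial. *)
have [D0|D0] := leP 0 (1 - (1 + h) / q%:R - 4 * h); last first.
  apply: (@le_trans _ _ 0); last first.
    by rewrite /cbf_ratio; apply: divr_ge0 => //; apply: divr_ge0 => //; exact: exprn_ge0.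
  apply: mulr_ge0_le0; last exact: ltW.
  by apply: mulr_ge0; [lra | exact: expR_ge0].
pose k := (p.+2 + p.+2)%N.
have kn : (k ^ 2 <= n)%N.
  apply: leq_trans nl; have -> : (k ^ 2 = 4 * p.+2 ^ 2)%N by rewrite /k -!mulnn; nia.
  apply: (@leq_trans (2 ^ (p + 4))); last by rewrite leq_exp2r // addn4.
  have -> : (p + 4 = 2 + p.+2)%N by lia.
  by rewrite expnD leq_mul2l sqr_le_exp2.
have n0 : (0 < n)%N by apply: leq_trans kn; rewrite expn_gt0.
pose M := (q ^ k %/ n)%N.
have Mn : (M * n <= q ^ k)%N := leq_trunc_div _ _.
have hMp : (M <= q ^ p)%N.
  rewrite -(leq_pmul2r n0); apply: (leq_trans Mn).
  have -> : (k = p + (p + 4))%N by rewrite /k; lia.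
  by rewrite expnD leq_mul2l nl orbT.
have kn' : (k <= n)%N by apply: leq_trans kn; rewrite -mulnn leq_pmulr.
have nE : n = (k + (n - k))%N by rewrite subnKC.
have := @max_cbf_ge_rate R q p M (n - k) q1 p2 hMp.
rewrite -/k -nE => /(_ kn Mn D0); rewrite -/h => bound.
have N0 : 0 < n%:R :> R by rewrite ltr0n.
have Q0 : 0 < q%:R :> R by rewrite ltr0n; lia.
rewrite /cbf_ratio ler_pdivlMr ?divr_gt0 ?exprn_gt0 //.
apply: le_trans bound.
have -> : q%:R ^+ n = q%:R ^+ k * q%:R ^+ (n - k) :> R by rewrite -exprD -nE.
rewrite [leLHS](_ : _ = (1 - 2 * h) * q%:R ^+ k / n%:R *
  (expR (- 1 - h) * q%:R ^+ (n - k) * (1 - (1 + h) / q%:R - 4 * h))); last by ring.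
rewrite -[leRHS]mulrA; apply: ler_wpM2r.
  by rewrite mulr_ge0 // mulr_ge0 ?expR_ge0 // exprn_ge0.
rewrite ler_pdivrMr //.
have Mlt : (q ^ k <= M * n + n)%N by have := ltn_ceil (q ^ k) n0; rewrite -/M; nia.
have small : (n * p.+1 <= 2 * q ^ k)%N.
  apply: (@leq_trans (q ^ (p + 5) * (2 * q ^ p.-1))).
    (* From [p.-1 < q ^ p.-1] follows [p.+1 <= 2 * q ^ p.-1], and the exponents [p + 5] and [p.-1]
       add up to [k]. *)
    apply: leq_mul; first exact: ltnW.
    by have := ltn_expl p.-1 q1; lia.
  rewrite mulnCA -expnD leq_mul2l /=.
  by have -> : (p + 5 + p.-1 = k)%N by rewrite /k; lia.
have MltR : q%:R ^+ k <= M%:R * n%:R + n%:R :> R.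
  by rewrite -natrX -natrM -natrD ler_nat.
have smallR : n%:R * p.+1%:R <= 2 * q%:R ^+ k :> R.
  by rewrite -natrX -!natrM ler_nat.
have : n%:R <= 2 * h * q%:R ^+ k :> R.
  by rewrite -mulrA mulrCA /h mulrC ler_pdivlMr ?ltr0n.
lra.
Qed.

(** The count gives [n / (2n - 1)]; the error term is a convenient majorant, equal to [harmonic n],
    whose limit is known. *)
Lemma cbf_ratio_le (R : realType) (q n : nat) :
  (0 < q)%N -> (0 < n)%N -> cbf_ratio R q n <= 1 / 2 + n.+1%:R^-1.
Proof.
move=> q0 n0.
have bound : (n.*2.-1 * max_cbf q n <= q ^ n)%N.
  rewrite /max_cbf; apply: (big_ind (fun x => (n.*2.-1 * x <= q ^ n)%N)) => [|x y hx hy|S /asboolP hS].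
      by rewrite muln0.
    by rewrite maxnMr geq_max hx.
  exact: cbf_card_bound.
have N0 : 0 < n%:R :> R by rewrite ltr0n.
have Q0 : 0 < q%:R ^+ n :> R by rewrite exprn_gt0 // ltr0n.
rewrite /cbf_ratio ler_pdivrMr ?divr_gt0 //.
move: bound; rewrite -(ler_nat R) natrM natrX.
have -> : n.*2.-1%:R = 2 * n%:R - 1 :> R.
  by rewrite -subn1 natrB ?double_gt0 // -mul2n natrM.
rewrite -(natr1 n); set N : R := n%:R in N0 *; set C : R := (max_cbf q n)%:R.
have N1 : 1 <= N by rewrite /N (ler_nat R 1).
move=> bound; rewrite mulrA ler_pdivlMr //.
have C1 : C <= q%:R ^+ n / (2 * N - 1) by rewrite ler_pdivlMr 1?mulrC //; lra.
have e : N / (2 * N - 1) <= 1 / 2 + (N + 1)^-1.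
  rewrite -subr_ge0.
  have -> : 1 / 2 + (N + 1)^-1 - N / (2 * N - 1) = (3 * N - 3) / (2 * (N + 1) * (2 * N - 1)).
    by field; lra.
  by apply: divr_ge0; [lra | apply: mulr_ge0; lra].
apply: (le_trans (ler_wpM2r (ltW N0) C1)).
rewrite [leLHS]mulrAC -[leLHS]mulrA [leRHS]mulrC.
exact: (ler_wpM2l (ltW Q0) e).
Qed.

Lemma lower_rate0 (R : realType) (q : nat) :
  (0 < q)%N -> lower_rate q (0 : R) = (q%:R - 1) / (q%:R * expR 1).
Proof.
move=> q0; have Q0 : q%:R != 0 :> R by rewrite pnatr_eq0 -lt0n.
rewrite /lower_rate !mulr0 !subr0 addr0 mul1r expRN; field.
by rewrite Q0 lt0r_neq0 ?expR_gt0.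
Qed.

Theorem theoremI1 (R : realType) (q : nat) (hq : (2 <= q)%N) :
  (((q%:R - 1) / (q%:R * expR 1))%:E
     <= limn_einf (fun n : nat => (cbf_ratio R q n)%:E))%E /\
  (limn_esup (fun n : nat => (cbf_ratio R q n)%:E) <= (1 / 2 : R)%:E)%E.
Proof.
have q0 : (0 < q)%N by lia.
split; last first.
  apply: (@limn_esup_le_lim _ _ (fun n => (1 / 2 + @harmonic R n)%:E)).
    by exists 1%N => // n n0; rewrite lee_fin; exact: cbf_ratio_le.
  apply: cvg_EFin; first exact: nearW.
  rewrite -[X in _ --> X]addr0; apply: cvgD; [exact: cvg_cst | exact: cvg_harmonic].
(* Chosen so that [q ^ (p n + 4) <= n < q ^ (p n + 5)] for large [n]. *)
pose p (n : nat) : nat := (trunc_log q n - 4)%N.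
have p_infty : p n @[n --> \oo] --> \oo.
  apply/cvgnyPge => A; exists (q ^ (A + 4))%N => // n /= hn.
  by rewrite -(addnK 4 A); apply: leq_sub2r; exact: trunc_log_max hq hn.
apply: (@limn_einf_ge_lim _ _ (fun n => (lower_rate q (@harmonic R (p n)))%:E)).
  (* From [q ^ 6] on the logarithm is at least 6, so the subtraction of 4 is exact and
     [p n >= 2]. *)
  exists (q ^ 6)%N => // n /= hn; rewrite lee_fin.
  have t6 := trunc_log_max hq hn.
  have n0 : (0 < n)%N by apply: leq_trans hn; rewrite expn_gt0 q0.
  have /andP[lo hi] := trunc_log_bounds hq n0.
  have p4 : (p n + 4 = trunc_log q n)%N by apply: subnK; exact: leq_trans t6.
  apply: cbf_ratio_ge => //; first exact: (leq_sub2r 4 t6).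
  by rewrite p4 addnS p4 lo hi.
apply: cvg_EFin; first exact: nearW.
(* The limit is now the value at 0 of [lower_rate], reached factor by factor as [h = 1 / (p n + 1)]
   tends to 0. *)
rewrite -lower_rate0 //.
have h_cvg : @harmonic R (p n) @[n --> \oo] --> (0 : R).
  by apply: (cvg_comp _ _ p_infty); exact: cvg_harmonic.
apply: cvgM; first apply: cvgM.
- by apply: cvgB; [exact: cvg_cst | apply: cvgMr].
- apply: continuous_cvg; first exact: continuous_expR.
  by apply: cvgB => //; exact: cvg_cst.
- apply: cvgB; last by apply: cvgMr.
  apply: cvgB; first exact: cvg_cst.
  by apply: cvgMl; apply: cvgD => //; exact: cvg_cst.
Qed.
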